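(* Let $R$ be an integral domain which is not a field, and let $M$ be a left $R$-module with nonempty torsion-free part, i.e. $M\neq\mathrm{Tor}(M)$. Then either $M$ is semisimple or $M$ does not possess an essential socle, i.e. $\mathrm{Soc}(M)$ is not a proper essential submodule of $M$.
   Context: $\mathrm{Tor}(M)=\{m\in M: rm=0\text{ for some nonzero } r\in R\}$. $\mathrm{Soc}(M)$ is the sum of all simple submodules of $M$. A submodule $E$ of $M$ is proper essential in $M$ if $E\neq\{0_M\}$, $E\neq M$, and $E\cap N\neq\{0_M\}$ for every nonzero submodule $N$ of $M$. A module is semisimple if it is a direct sum of simple submodules. *)

(* Defs.v *)
From mathcomp Require Import all_boot all_algebra.
From mathcomp Require Export boolp classical_sets.

Set Implicit Arguments.
Unset Strict Implicit.
Unset Printing Implicit Defensive.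

Import GRing.Theory.

Local Open Scope ring_scope.
Local Open Scope classical_set_scope.

Section Submodules.
Variables (R : idomainType) (M : lmodType R).

(* Submodules are Prop-valued subsets, so that they need not be decidable. *)
Definition submodule (N : set M) : Prop := GRing.submod_closed (mem N).

Definition simple_submodule (S : set M) : Prop :=
  [/\ submodule S, S <> [set 0] &
      forall N : set M, submodule N -> N `<=` S -> N = [set 0] \/ N = S].

(* The sum of a possibly infinite family of submodules: all finite sums of
   elements of its members. *)
Definition sum_submodules (F : set (set M)) : set M :=
  [set m | exists2 s : seq M,
     (forall x, x \in s -> exists2 N, F N & N x) & m = \sum_(x <- s) x].

(* A family given as a set has no repeated members; this loses nothing for
   simple submodules, which are nonzero. *)
Definition direct_sum_decomposition (F : set (set M)) : Prop :=
  [/\ forall N, F N -> submodule N,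
      sum_submodules F = setT &
      forall N, F N -> N `&` sum_submodules (F `\ N) = [set 0]].

Definition proper_essential (E : set M) : Prop :=
  [/\ submodule E, E <> [set 0], E <> setT &
      forall N : set M, submodule N -> N <> [set 0] -> E `&` N <> [set 0]].

End Submodules.

Definition Tor (R : idomainType) (M : lmodType R) : set M :=
  [set m | exists2 r : R, r != 0 & r *: m = 0].

Definition Soc (R : idomainType) (M : lmodType R) : set M :=
  sum_submodules [set S : set M | simple_submodule S].

Definition semisimple (R : idomainType) (M : lmodType R) : Prop :=
  exists2 F : set (set M), (forall S, F S -> simple_submodule S) &
    direct_sum_decomposition F.

Arguments Tor {R} M _.
Arguments Soc {R} M _.
Arguments semisimple {R} M.

Lemma submoduleP (R : idomainType) (M : lmodType R) (N : set M) :
  submodule N <->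
  [/\ N 0, forall u v, N u -> N v -> N (u + v) & forall a u, N u -> N (a *: u)].
Proof.
rewrite /submodule; split=> [[/set_mem N0 Nlin]|[N0 ND NZ]].
  have Nl a u v : N u -> N v -> N (a *: u + v).
    by move=> Nu Nv; apply/set_mem/Nlin; apply/mem_set.
  split=> // [u v Nu Nv|a u Nu]; first by rewrite -[u]scale1r; apply: Nl.
  by rewrite -[_ *: _]addr0; apply: Nl.
split=> [|a u v /set_mem Nu /set_mem Nv]; apply/mem_set => //.
by apply: ND => //; apply: NZ.
Qed.

Lemma submodule_sum (R : idomainType) (M : lmodType R) (F : set (set M)) :
  (forall N, F N -> submodule N) -> submodule (sum_submodules F).
Proof.
move=> FP; apply/submoduleP; split.
- by exists [::]; rewrite ?big_nil.
- move=> _ _ [s sP ->] [t tP ->]; exists (s ++ t); last by rewrite big_cat.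
  by move=> x; rewrite mem_cat => /orP[/sP|/tP].
- move=> a _ [s sP ->]; exists [seq a *: x | x <- s]; last first.
    by rewrite big_map scaler_sumr.
  move=> _ /mapP[x /sP[N FN Nx] ->]; exists N => //.
  by have /submoduleP[_ _ NZ] := FP _ FN; apply: NZ.
Qed.

Lemma submodule_Soc (R : idomainType) (M : lmodType R) : submodule (Soc M).
Proof. by apply: submodule_sum => S []. Qed.

(* Main.v *)
(* Over a domain that is not a field every element x of a simple module is
   torsion: for a nonzero nonunit r, either r x = 0, or r x generates the
   module and x = s r x, so that the nonzero scalar 1 - s r kills x. Hence the
   socle is torsion, whereas a torsion-free element m generates a copy of R,
   which contains no nonzero torsion; so the socle is never essential. *)

Require Import Defs.
From mathcomp Require Import all_boot all_algebra boolp classical_sets.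

Set Implicit Arguments.
Unset Strict Implicit.
Unset Printing Implicit Defensive.

Local Open Scope ring_scope.
Local Open Scope classical_set_scope.

Import GRing.Theory.

Section TorsionSocle.
Variables (R : idomainType) (M : lmodType R).

Definition cyclic_submodule (x : M) : set M := range (fun a : R => a *: x).

Lemma mem_cyclic (x : M) : cyclic_submodule x x.
Proof. by exists 1 => //; rewrite scale1r. Qed.

Lemma submodule_cyclic (x : M) : submodule (cyclic_submodule x).
Proof.
apply/submoduleP; split=> [|_ _ [a _ <-] [b _ <-]|b _ [a _ <-]].
- by exists 0 => //; rewrite scale0r.
- by exists (a + b) => //; rewrite scalerDl.
- by exists (b * a) => //; rewrite scalerA.
Qed.

Lemma cyclic_neq0 (x : M) : x != 0 -> cyclic_submodule x <> [set 0].
Proof. by move=> x0 Cx0; have := mem_cyclic x; rewrite Cx0; apply/eqP. Qed.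

Lemma Tor0 : Tor M 0.
Proof. by exists 1; rewrite ?oner_neq0 ?scaler0. Qed.

(** The product of the two annihilating scalars kills the sum, and it is nonzero because [R] is a
    domain. *)
Lemma TorD (x y : M) : Tor M x -> Tor M y -> Tor M (x + y).
Proof.
move=> [a a0 ax0] [b b0 by0]; exists (a * b); first by rewrite mulf_neq0.
by rewrite scalerDr -[_ *: y]scalerA by0 mulrC -scalerA ax0 !scaler0 addr0.
Qed.

(** Read contrapositively: nonzero multiples of a torsion-free element stay torsion-free. *)
Lemma Tor_scale (a : R) (x : M) : a != 0 -> Tor M (a *: x) -> Tor M x.
Proof.
move=> a0 [b b0 bax0]; exists (b * a); first by rewrite mulf_neq0.
by rewrite -scalerA.
Qed.

Lemma simple_sub_Tor (S : set M) :
  ~ GRing.field_axiom R -> simple_submodule S -> S `<=` Tor M.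
Proof.
move=> nfR [Smod _ Smin] x Sx.
have /existsNP[r /not_implyP[r0 /negP rNunit]] := nfR.
have [rx0|rx0] := eqVneq (r *: x) 0; first by exists r.
have /submoduleP[_ _ SZ] := Smod.
have sub : cyclic_submodule (r *: x) `<=` S by move=> _ [a _ <-]; exact/SZ/SZ.
(* Since [r *: x] is nonzero, minimality forces it to generate all of [S]. *)
have [/cyclic_neq0 //|CS] := Smin _ (submodule_cyclic _) sub.
move: (Sx); rewrite -CS => -[s _ srx].
exists (1 - s * r); last by rewrite scalerBl scale1r -scalerA srx subrr.
(* If [1 - s * r] vanished, [s] would invert the nonunit [r]. *)
apply: contra rNunit; rewrite subr_eq0 => /eqP sr1.
by apply/unitrP; exists s; rewrite [r * s]mulrC.
Qed.

Lemma Soc_sub_Tor : ~ GRing.field_axiom R -> Soc M `<=` Tor M.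
Proof.
(* [big_seq] keeps membership in [s] at hand, so each summand is known to lie in a simple
   submodule. *)
move=> nfR _ [s sS ->]; rewrite big_seq.
apply: (big_ind (fun x => Tor M x)) => [|x y|x /sS[S Ssimple Sx]].
- exact: Tor0.
- exact: TorD.
- exact: simple_sub_Tor Sx.
Qed.

Lemma Soc_not_essential :
  ~ GRing.field_axiom R -> [set: M] <> Tor M -> ~ proper_essential (Soc M).
Proof.
move=> nfR MTor [_ _ _ ess]; apply: MTor; apply/seteqP; split=> // m _.
apply: contrapT => mNTor.
have m0 : m != 0 by apply: contra_notN mNTor => /eqP->; exact: Tor0.
(* Essentiality is tested on the multiples of [m], which meet the socle only in 0. *)
apply: (ess _ (submodule_cyclic m) (cyclic_neq0 m0)); apply/seteqP; split.
  move=> x [/(Soc_sub_Tor nfR) xTor [a _ eq_am]].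
  rewrite -{}eq_am /= in xTor *.
  have [->|a0] := eqVneq a 0; first by rewrite scale0r.
  by case: mNTor; apply: Tor_scale xTor.
move=> _ ->; split; first by have /submoduleP[] := submodule_Soc M.
by have /submoduleP[] := submodule_cyclic m.
Qed.

End TorsionSocle.

Theorem theorem4p8 (R : idomainType) (M : lmodType R)
    (hR : ~ GRing.field_axiom R) (hM : [set: M] <> Tor M) :
  semisimple M \/ ~ proper_essential (Soc M).
Proof. by right; apply: Soc_not_essential. Qed.
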